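(* Let $a\in\mathcal{A}$ and let $m\geq 1$ be an integer. Then $a$ has an $m$-generalized right group inverse if and only if $a^m$ has a generalized right group inverse. In this case: for every generalized right group inverse $y$ of $a^m$, the element $a^{m-1}y$ is an $m$-generalized right group inverse of $a$; and for every $m$-generalized right group inverse $x$ of $a$, the element $x^m$ is a generalized right group inverse of $a^m$.
   Context: $\mathcal{A}$ is a unital complex Banach *-algebra, i.e. a Banach algebra with an involution $*$ satisfying $(x+y)^*=x^*+y^*$, $(\lambda x)^*=\overline{\lambda}x^*$, $(xy)^*=y^*x^*$, $(x^* )^*=x$; the involution is assumed proper: $x^*x=0$ implies $x=0$. $\mathcal{A}^{qnil}=\{x\in\mathcal{A}: \lim_{n\to\infty}\|x^n\|^{1/n}=0\}$. An element $d\in\mathcal{A}$ is a generalized right Drazin inverse of $a$ if $ad^2=d$, $a^2d=ada$ and $a-ada\in\mathcal{A}^{qnil}$ (it need not be unique). An element $x\in\mathcal{A}$ is an $m$-generalized right group inverse of $a$ if there is a generalized right Drazin inverse $d$ of $a$ such that $x=ax^2$, $(ad)^*a^{m+1}x=(ad)^*a^m$ and $\lim_{n\to\infty}\|a^n-axa^n\|^{1/n}=0$. It need not be unique. A generalized right group inverse is a $1$-generalized right group inverse (the case $m=1$). *)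

(* Defs.v *)
From HB Require Import structures.
From mathcomp Require Import all_boot all_order all_algebra.
From mathcomp Require Import complex.
From mathcomp Require Import all_classical all_reals all_analysis.
Set Implicit Arguments.
Unset Strict Implicit.
Unset Printing Implicit Defensive.
Import Order.TTheory GRing.Theory Num.Theory.
Import numFieldNormedType.Exports.
Local Open Scope classical_set_scope.
Local Open Scope ring_scope.
Local Open Scope complex_scope.

(* Ring and normed-module structures cannot be joined generically in the
   library hierarchy (their join is already numDomainType), so the product is
   given as raw data on a complete normed space; the carrier below then gets
   the library's instances of both.  The zero algebra is allowed (hence no
   algType instance, which needs 1 != 0), the norm of the unit is not required
   to be 1, and the involution is required to be neither isometric nor
   continuous. *)
Record banachStarAlg (R : realType) := BanachStarAlg {
  bsa_space : completeNormedModType R[i];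
  bsa_one : bsa_space;
  bsa_mul : bsa_space -> bsa_space -> bsa_space;
  bsa_star : bsa_space -> bsa_space;
  bsa_mulA : associative bsa_mul;
  bsa_mul1x : left_id bsa_one bsa_mul;
  bsa_mulx1 : right_id bsa_one bsa_mul;
  bsa_mulDl : left_distributive bsa_mul +%R;
  bsa_mulDr : right_distributive bsa_mul +%R;
  bsa_scaleAl : forall (l : R[i]) x y, l *: bsa_mul x y = bsa_mul (l *: x) y;
  bsa_scaleAr : forall (l : R[i]) x y, l *: bsa_mul x y = bsa_mul x (l *: y);
  bsa_normM : forall x y, `|bsa_mul x y| <= `|x| * `|y|;
  bsa_starD : forall x y, bsa_star (x + y) = bsa_star x + bsa_star y;
  bsa_starZ : forall (l : R[i]) x,
    bsa_star (l *: x) = Num.conj l *: bsa_star x;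
  bsa_starM : forall x y,
    bsa_star (bsa_mul x y) = bsa_mul (bsa_star y) (bsa_star x);
  bsa_starK : involutive bsa_star
}.

Definition bsa_carrier (R : realType) (A : banachStarAlg R) : Type :=
  bsa_space A.
Coercion bsa_carrier : banachStarAlg >-> Sortclass.

Section BanachStarAlgebraInstances.
Context (R : realType) (A : banachStarAlg R).

HB.instance Definition _ :=
  CompleteNormedModule.copy (bsa_carrier A) (bsa_space A).
HB.instance Definition _ := GRing.Zmodule_isPzRing.Build (bsa_carrier A)
  (@bsa_mulA R A) (@bsa_mul1x R A) (@bsa_mulx1 R A)
  (@bsa_mulDl R A) (@bsa_mulDr R A).

End BanachStarAlgebraInstances.

Section GeneralizedRightInverses.
Context (R : realType) (A : banachStarAlg R).
Implicit Types (a d x : A) (m : nat).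

Definition star x : A := bsa_star x.

Definition proper_star : Prop := forall x, star x * x = 0 -> x = 0.

(* The library norm of A takes values in R[i]; these values are nonnegative
   reals, so taking the real part loses nothing. *)
Definition rnorm x : R := complex.Re `|x|.

Definition root_norm_cvg0 (u : nat -> A) : Prop :=
  (rnorm (u n) `^ (n%:R^-1)) @[n --> \oo] --> (0 : R).

Definition qnil : set A := [set x | root_norm_cvg0 (fun n => x ^+ n)].

Definition gen_right_drazin_inverse a d : Prop :=
  [/\ a * d ^+ 2 = d, a ^+ 2 * d = a * d * a & qnil (a - a * d * a)].

Definition m_gen_right_group_inverse m a x : Prop :=
  exists d, [/\ gen_right_drazin_inverse a d,
    x = a * x ^+ 2,
    star (a * d) * a ^+ m.+1 * x = star (a * d) * a ^+ m &
    root_norm_cvg0 (fun n => a ^+ n - a * x * a ^+ n)].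

Definition gen_right_group_inverse a x : Prop :=
  m_gen_right_group_inverse 1 a x.

End GeneralizedRightInverses.

Arguments proper_star {R} A.

(* Main.v *)
(* From [a] to [a ^+ m] everything is algebra and passage to subsequences,
   because [a * x ^+ 2 = x] gives [a ^+ m * x ^+ m = a * x], and likewise for a
   right Drazin inverse [d] of [a].

   Conversely, let [d] be a generalized right Drazin inverse of [b = a ^+ m] and
   [p = b * d].  The range of [p] is determined by [b] (it consists of the
   vectors with backward [b]-orbits of at most geometric growth), hence is
   invariant under [a]; but the range of [1 - p] is not, so [p] need not commute
   with [a] and [a ^+ m.-1 * d] need not be a generalized right Drazin inverse
   of [a].  A convergent series corrects [p] to an idempotent [p'] with the same
   range that commutes with [a], and [e = a ^+ m.-1 * d * p'] is then a
   generalized right Drazin inverse of [a] with [a * e = p'].  Since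
   [p' = p * p'], the adjoint of [p'] is a left multiple of that of [p], which
   transfers the condition involving the involution from [p] to [p']. *)
Require Import Defs.
From mathcomp Require Import all_boot all_order all_algebra.
From mathcomp Require Import complex.
From mathcomp Require Import all_classical all_reals all_analysis.
From mathcomp Require Import lra.
Import Order.TTheory GRing.Theory Num.Theory.
Import numFieldNormedType.Exports.
Local Open Scope classical_set_scope.
Local Open Scope ring_scope.

(** * Sequences decaying faster than every geometric rate *)

Section RootNorm.
Context {R : realType} {A : banachStarAlg R}.
Implicit Types (x y z q : A) (u v s : nat -> A).

Lemma rnormE x : `|x| = (rnorm x)%:C%C.
Proof. by rewrite /rnorm RRe_real ?normr_real. Qed.

Lemma rnorm_ge0 x : 0 <= rnorm x.
Proof. by have := normr_ge0 x; rewrite rnormE ler0c. Qed.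

Lemma rnorm_eq0 x : rnorm x <= 0 -> x = 0.
Proof.
move=> h; apply/normr0_eq0; rewrite rnormE.
by have -> : rnorm x = 0 by apply/eqP; rewrite eq_le h rnorm_ge0.
Qed.

Lemma ler_rnormM x y : rnorm (x * y) <= rnorm x * rnorm y.
Proof. by have := bsa_normM x y; rewrite !rnormE -rmorphM lecR. Qed.

Lemma ler_rnormX x n : rnorm (x ^+ n) <= rnorm (1 : A) * rnorm x ^+ n.
Proof.
elim: n => [|n IHn]; first by rewrite !expr0 mulr1.
rewrite exprSr (le_trans (ler_rnormM _ _))// exprSr mulrA.
by rewrite ler_wpM2r// rnorm_ge0.
Qed.

Lemma root_norm_cvg0P u : root_norm_cvg0 u <->
  forall e : R, 0 < e -> exists N, forall n, (N <= n)%N -> rnorm (u n) <= e ^+ n.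
Proof.
split=> [/cvgrPdist_le h e e0|h].
  (* [N.+1] keeps [n] nonzero: at [n = 0] the exponent [n%:R^-1] is [0]. *)
  have [N _ hN] := h e e0; exists N.+1 => n Nn.
  have n0 : n%:R != 0 :> R by rewrite pnatr_eq0; case: n Nn.
  have := hN n (ltnW Nn); rewrite /= sub0r normrN ger0_norm ?powR_ge0// => le_e.
  rewrite -[leLHS]powRr1 ?rnorm_ge0// -(mulVf n0) powRrM powR_mulrn ?powR_ge0//.
  by rewrite lerXn2r ?nnegrE ?powR_ge0// ltW.
apply/cvgrPdist_le => e e0; have [N hN] := h e e0.
exists N.+1 => // n /= Nn.
have n0 : n%:R != 0 :> R by rewrite pnatr_eq0; case: n Nn.
have {}Nn := ltnW Nn.
rewrite sub0r normrN ger0_norm ?powR_ge0//.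
apply: (@le_trans _ _ ((e ^+ n) `^ n%:R^-1)).
  by rewrite ge0_ler_powR ?nnegrE ?invr_ge0 ?ler0n ?rnorm_ge0 ?exprn_ge0 ?hN ?(ltW e0).
by rewrite -powR_mulrn ?(ltW e0)// -powRrM mulfV// powRr1 ?lexx ?(ltW e0).
Qed.

Lemma geometric_le (M e : R) : 0 < e ->
  exists N, forall n, (N <= n)%N -> M * 2^-1 ^+ n <= e.
Proof.
move=> e0.
have /cvgrPdist_le/(_ e e0)[N _ hN] : geometric M (2^-1 : R) @ \oo --> (0 : R).
  by apply: cvg_geometric; rewrite ger0_norm ?invr_ge0// invf_lt1// ltr1n.
exists N => n /hN; rewrite /= sub0r normrN; exact: le_trans (ler_norm _).
Qed.

Lemma root_norm_cvg0_bound u (C K : R) : 0 <= C -> 0 <= K ->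
  root_norm_cvg0 u ->
  exists N, forall n, (N <= n)%N -> C * K ^+ n * rnorm (u n) <= C * 2^-1 ^+ n.
Proof.
move=> C0 K0 /root_norm_cvg0P h.
have K1 : 0 < K + 1 by lra.
(* [K + 1] in place of [K] covers [K = 0], and still [K / (K + 1) <= 1]. *)
have [|N hN] := h (2^-1 / (K + 1)); first by rewrite divr_gt0// invr_gt0.
exists N => n /hN le_u; rewrite -mulrA ler_wpM2l//.
apply: le_trans (ler_wpM2l (exprn_ge0 n K0) le_u) _.
rewrite -exprMn lerXn2r ?nnegrE ?mulr_ge0 ?divr_ge0 ?invr_ge0//; try lra.
by rewrite mulrCA ler_piMr ?invr_ge0// ler_pdivrMr//; lra.
Qed.

Lemma root_norm_cvg0_dominated (M : R) u v :
    (forall n, (0 < n)%N -> rnorm (v n) <= M * rnorm (u n)) ->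
  root_norm_cvg0 u -> root_norm_cvg0 v.
Proof.
move=> le_vu /root_norm_cvg0P h; apply/root_norm_cvg0P => e e0.
have [|N hN] := h (e / 2); first by rewrite divr_gt0.
have [//|N' hN'] := @geometric_le `|M| 1.
exists (maxn N.+1 N') => n; rewrite geq_max => /andP[Nn N'n].
have n0 : (0 < n)%N by case: n Nn {N'n}.
apply: le_trans (le_vu n n0) _.
apply: (@le_trans _ _ (`|M| * (e / 2) ^+ n)).
  apply: (@le_trans _ _ (`|M| * rnorm (u n))).
    by rewrite ler_wpM2r ?rnorm_ge0// ler_norm.
  by rewrite ler_wpM2l// hN// ltnW.
rewrite exprMn mulrCA ler_piMr ?exprn_ge0 ?(ltW e0) ?hN'//.
Qed.

Lemma root_norm_cvg0_mull x u :
  root_norm_cvg0 u -> root_norm_cvg0 (fun n => x * u n).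
Proof. by apply: (@root_norm_cvg0_dominated (rnorm x)) => n _; exact: ler_rnormM. Qed.

Lemma eq_root_norm_cvg0 u v : (forall n, (0 < n)%N -> u n = v n) ->
  root_norm_cvg0 u <-> root_norm_cvg0 v.
Proof.
by move=> uv; split; apply: (@root_norm_cvg0_dominated 1) => n /uv ->;
   rewrite mul1r.
Qed.

(** One direction is a subsequence. For the other, write [n = m * i + r] with [r < m]; the factors
    [x ^+ r] are bounded by a constant [M]. *)
Lemma root_norm_cvg0_pow m q x : (0 < m)%N ->
  root_norm_cvg0 (fun n => q * (x ^+ m) ^+ n) <->
  root_norm_cvg0 (fun n => q * x ^+ n).
Proof.
move=> m0; split=> /root_norm_cvg0P h; apply/root_norm_cvg0P => e e0; last first.
  have [|N hN] := h (Num.min e 1); first by rewrite lt_min e0/=.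
  exists N => n Nn; rewrite -exprM.
  apply: le_trans (hN _ (leq_trans Nn (leq_pmull _ m0))) _.
  have d0 : 0 <= Num.min e 1 by rewrite le_min ler01 ltW.
  rewrite exprM lerXn2r ?nnegrE ?exprn_ge0//; try exact: ltW.
  apply: (@le_trans _ _ (Num.min e 1)); last by rewrite ge_min lexx.
  by rewrite -[leRHS]expr1 ler_wiXn2l// ge_min lexx orbT.
pose d := Num.min e 1.
have d0 : 0 < d by rewrite lt_min e0/=.
have d1 : d <= 1 by rewrite ge_min lexx orbT.
(* The halves give [2^-1 ^+ i], which brings [M] below [d ^+ m], hence below [d ^+ r] as
   [d <= 1]. *)
have [|N hN] := h (d ^+ m / 2); first by rewrite divr_gt0// exprn_gt0.
pose M := \sum_(r < m) rnorm (x ^+ r).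
have [|N' hN'] := @geometric_le M (d ^+ m); first by rewrite exprn_gt0.
exists (m * maxn N N')%N => n.
rewrite mulnC -leq_divRL// geq_max => /andP[Ni N'i].
apply: (@le_trans _ _ (d ^+ n)); last first.
  by rewrite lerXn2r ?nnegrE ?(ltW d0) ?(ltW e0)// ge_min lexx.
have rm := ltn_pmod n m0.
have nE : n = (m * (n %/ m) + n %% m)%N by rewrite mulnC -divn_eq.
have leM : rnorm (x ^+ (n %% m)) <= M.
  rewrite /M (bigD1 (Ordinal rm))//= lerDl sumr_ge0// => *; exact: rnorm_ge0.
rewrite nE !exprD !exprM mulrA.
apply: (le_trans (ler_rnormM _ _)).
apply: le_trans (ler_pM (rnorm_ge0 _) (rnorm_ge0 _) (hN _ Ni) leM) _.
rewrite exprMn -mulrA ler_wpM2l ?exprn_ge0 ?(ltW d0)//.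
rewrite mulrC; apply: le_trans (hN' _ N'i) _.
by rewrite ler_wiXn2l ?(ltW d0)// ltnW.
Qed.

Lemma cvg_mul_seq x y s z : s @ \oo --> z ->
  (fun n => x * s n * y) @ \oo --> x * z * y.
Proof.
move=> /cvgrPdist_le h; apply/cvgrPdist_le => e e0.
pose M : R := rnorm x * rnorm y + 1.
have M0 : 0 < M by rewrite ltr_wpDl// mulr_ge0// rnorm_ge0.
have [|N _ hN] := h (e / M%:C%C); first by rewrite divr_gt0// ltcR.
exists N => // n /hN /=; rewrite ler_pdivlMr ?ltcR//; apply: le_trans.
rewrite -mulrBl -mulrBr !rnormE -rmorphM lecR.
apply: le_trans (ler_rnormM _ _) _.
apply: le_trans (ler_wpM2r (rnorm_ge0 _) (ler_rnormM _ _)) _.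
rewrite mulrAC mulrC ler_wpM2l ?rnorm_ge0// /M lerDl; exact: ler01.
Qed.

(** From some rank on a geometric series of ratio 1/2 dominates, so the partial sums are Cauchy. *)
Lemma cvg_root_norm_series u s (C K : R) : 0 <= C -> 0 <= K ->
    root_norm_cvg0 u ->
    (forall n, rnorm (s n) <= C * K ^+ n * rnorm (u n)) ->
  exists z, series s @ \oo --> z.
Proof.
move=> C0 K0 hu le_su; apply/cvg_ex; apply/cauchy_cvgP/cauchy_seriesP => e e0.
have [N hN] := root_norm_cvg0_bound _ _ _ C0 K0 hu.
have eE : e = (complex.Re e)%:C%C by rewrite RRe_real// gtr0_real.
have : cvgn (series (geometric C (2^-1 : R))).
  by apply: is_cvg_geometric_series; rewrite ger0_norm ?invr_ge0// invf_lt1// ltr1n.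
move=> /cauchy_cvgP/cauchy_seriesP/(_ (complex.Re e)).
rewrite -ltcR -eE => /(_ e0); case=> -[P Q] /= [hP hQ] sub.
exists (P `&` [set n | (N <= n)%N], Q) => /=.
  by split=> //; apply: filterI => //; exists N.
move=> [i j] /= [[Pi Ni] Qj]; have /sub/= : (P `*` Q) (i, j) by split.
rewrite eE rnormE ltcR; apply: le_lt_trans; apply: le_trans (ler_norm _).
have rnorm_sum : rnorm (\sum_(i <= k < j) s k) <= \sum_(i <= k < j) rnorm (s k).
  rewrite -lecR -rnormE rmorph_sum (le_trans (ler_norm_sum _ _ _))//.
  by rewrite ler_sum// => k _; rewrite rnormE.
apply: le_trans rnorm_sum _; rewrite !big_nat ler_sum// => k /andP[ik _].
by apply: le_trans (le_su k) _; apply: hN; exact: leq_trans ik.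
Qed.

End RootNorm.

(** * Power identities in a ring *)

Lemma exprM_right_inv (T : pzRingType) (a x : T) m j : a * x ^+ 2 = x ->
  a ^+ m * x ^+ (m + j.+1) = x ^+ j.+1.
Proof.
move=> ax2; elim: m => [|m IHm]; first by rewrite expr0 mul1r.
(* Each [a] turns two factors [x] into one; the exponent [j.+1] ensures that two are present. *)
rewrite exprSr -mulrA -[RHS]IHm; congr (_ * _).
by rewrite addSn addnS -addn2 addnC exprD mulrA ax2 -exprS.
Qed.

Lemma exprMX_right_inv (T : pzRingType) (a x : T) m : a * x ^+ 2 = x ->
  a ^+ m.+1 * x ^+ m.+1 = a * x.
Proof. by move=> ax2; rewrite exprS -mulrA -addn1 exprM_right_inv// expr1. Qed.

(** Exponent [0] is excluded because [(q * a) ^+ 0] is [1]; this is why sequences are compared only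
    for [0 < n]. *)
Lemma exprMl_compress (T : pzRingType) (q a : T) n : q * a * q = q * a ->
  (q * a) ^+ n.+1 = q * a ^+ n.+1.
Proof.
move=> qaq; elim: n => [//|n IHn].
by rewrite exprS IHn mulrA qaq [in RHS]exprS mulrA.
Qed.

(** * Quasinilpotent compressions and annihilation *)

Section GeneralizedInverses.
Context {R : realType} {A : banachStarAlg R}.
Implicit Types (a b d x y z q : A).

Lemma starM x y : star (x * y) = star y * star x.
Proof. exact: bsa_starM. Qed.

Lemma qnil_compress q a : q * a * q = q * a ->
  qnil (q * a) <-> root_norm_cvg0 (fun n => q * a ^+ n).
Proof.
by move=> qaq; apply: eq_root_norm_cvg0 => -[//|n] _; rewrite exprMl_compress.
Qed.

(* [y = b ^+ n * y ^+ n.+1] for every [n], so that [q * z * y] equals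
   [q * b ^+ n * z * y ^+ n.+1], which tends to [0]. *)
Lemma root_norm_cvg0_annihilates q b y z : b * y ^+ 2 = y -> z * b = b * z ->
  root_norm_cvg0 (fun n => q * b ^+ n) -> q * z * y = 0.
Proof.
move=> by2 zb hq; apply: rnorm_eq0; apply/ler_addgt0Pr => e e0; rewrite add0r.
pose C := rnorm z * (rnorm (1 : A) * rnorm y).
have C0 : 0 <= C by rewrite !mulr_ge0 ?rnorm_ge0.
have [N hN] := root_norm_cvg0_bound _ C (rnorm y) C0 (rnorm_ge0 y) hq.
have [N' hN'] := geometric_le C e e0.
pose n := maxn N N'.
have -> : q * z * y = q * b ^+ n * (z * (y ^+ n * y)).
  rewrite -exprSr -[y in LHS](exprM_right_inv _ b y n 0 by2) addn1.
  by rewrite -!mulrA; congr (_ * _); rewrite !mulrA (commrX n zb).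
apply: le_trans (hN' n (leq_maxr _ _)); apply: le_trans (hN n (leq_maxl _ _)).
apply: (le_trans (ler_rnormM _ _)); rewrite mulrC ler_wpM2r ?rnorm_ge0//.
apply: (le_trans (ler_rnormM _ _)); rewrite /C -!mulrA ler_wpM2l ?rnorm_ge0//.
apply: (le_trans (ler_rnormM _ _)); rewrite [_ * _ ^+ n]mulrC mulrA.
by rewrite ler_wpM2r ?rnorm_ge0// ler_rnormX.
Qed.

Lemma root_norm_cvg0_subE q a :
  root_norm_cvg0 (fun n => a ^+ n - q * a ^+ n) <->
  root_norm_cvg0 (fun n => (1 - q) * a ^+ n).
Proof. by apply: eq_root_norm_cvg0 => n _; rewrite mulrBl mul1r. Qed.

(** * The idempotent of a generalized right Drazin inverse *)

Section RightDrazin.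
Variables a d : A.
Hypothesis ad : gen_right_drazin_inverse a d.

Lemma gen_right_drazin_comm : a * (a * d) = a * d * a.
Proof. by case: ad => _ <- _; rewrite expr2 mulrA. Qed.

Lemma gen_right_drazin_idem : a * d * (a * d) = a * d.
Proof.
rewrite mulrA -gen_right_drazin_comm -!mulrA -expr2.
by case: ad => ->.
Qed.

Lemma gen_right_drazin_compl_comm : (1 - a * d) * a = a * (1 - a * d).
Proof. by rewrite mulrBl mulrBr mul1r mulr1 gen_right_drazin_comm. Qed.

Lemma gen_right_drazin_compl_idem : (1 - a * d) * (1 - a * d) = 1 - a * d.
Proof. by rewrite mulrBl mul1r mulrBr mulr1 gen_right_drazin_idem subrr subr0. Qed.

(** [a - a * d * a] is the compression of [a] by the idempotent [1 - a * d], which commutes with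
    [a]. *)
Lemma gen_right_drazin_complX :
  root_norm_cvg0 (fun n => (1 - a * d) * a ^+ n).
Proof.
case: (ad) => _ _; have -> : a - a * d * a = (1 - a * d) * a.
  by rewrite mulrBl mul1r.
move/qnil_compress; apply.
by rewrite {1}gen_right_drazin_compl_comm -mulrA gen_right_drazin_compl_idem
           gen_right_drazin_compl_comm.
Qed.

End RightDrazin.

(** * Generalized right Drazin inverses of powers and roots *)

Lemma gen_right_drazin_invX a d m : gen_right_drazin_inverse a d ->
  gen_right_drazin_inverse (a ^+ m.+1) (d ^+ m.+1).
Proof.
move=> ad; have [ad2 _ _] := ad.
have comm := gen_right_drazin_comm _ _ ad.
have pX : a ^+ m.+1 * d ^+ m.+1 = a * d by exact: exprMX_right_inv.
split; first by rewrite -exprM muln2 -addnn exprM_right_inv.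
  rewrite pX expr2 -mulrA pX; exact/esym/commrX/esym.
rewrite pX; have -> : a ^+ m.+1 - a * d * a ^+ m.+1 = (1 - a * d) * a ^+ m.+1.
  by rewrite mulrBl mul1r.
have cX : (1 - a * d) * a ^+ m.+1 = a ^+ m.+1 * (1 - a * d).
  exact/commrX/(gen_right_drazin_compl_comm _ _ ad).
apply/qnil_compress.
  by rewrite {1}cX -mulrA gen_right_drazin_compl_idem.
apply/root_norm_cvg0_pow => //; exact: gen_right_drazin_complX.
Qed.

(* Relative to the idempotent [p = a ^+ k.+1 * d], [a] is block upper
   triangular with a right invertible corner [p * a * p], a quasinilpotent
   corner [q * a] and off-diagonal part [B = p * a * q].  The sum [S] of
   [f ^+ i.+1 * B * a ^+ i] solves the Sylvester equation [a * S = B + S * a],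
   so that [p + S] is an idempotent with the range of [p] commuting with [a]. *)
Lemma gen_right_drazin_root a d k : gen_right_drazin_inverse (a ^+ k.+1) d ->
  exists2 e, gen_right_drazin_inverse a e &
    a ^+ k.+1 * d * (a * e) = a * e.
Proof.
move=> bd; have [bd2 _ _] := bd.
set b := a ^+ k.+1 in bd bd2 *; pose p := b * d; pose q := 1 - p.
(* [f] inverts [a] from the right on the range of [p]: [a * f = p] and [p * f = f]. *)
pose f := a ^+ k * d.
have pp : p * p = p := gen_right_drazin_idem _ _ bd.
have ab : a * b = b * a by rewrite /b -exprS -exprSr.
have aib i : a ^+ i * b = b * a ^+ i by exact/esym/commrX/esym.
have qb : root_norm_cvg0 (fun n => q * b ^+ n) := gen_right_drazin_complX _ _ bd.
(* Elements commuting with [b], such as the powers of [a], leave the range of [p] invariant. *)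
have qzd z : z * b = b * z -> q * z * d = 0.
  by move=> zb; exact: root_norm_cvg0_annihilates qb.
have qzp z : z * b = b * z -> q * z * p = 0.
  by move=> zb; rewrite /p mulrA -(mulrA q) qzd// mulrA -zb.
have pf : p * f = f.
  by apply/esym/eqP; rewrite -subr_eq0 -[X in X - _]mul1r -mulrBl mulrA qzd ?aib.
have af : a * f = p by rewrite /f mulrA -exprS.
have pE : p = b * d by [].
rewrite -pE; clearbody p f => {pE}.
have qE z : z - p * z = q * z by rewrite mulrBl mul1r.
have qap : q * a * p = 0 by exact: qzp.
have pap : p * a * p = a * p.
  by apply/esym/eqP; rewrite -subr_eq0 -!mulrA qE mulrA qap.
have qa : root_norm_cvg0 (fun n => q * a ^+ n).
  by apply/(root_norm_cvg0_pow k.+1).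
(* The decay of [q * a ^+ i] beats the at most geometric growth of [f ^+ i.+1]. *)
pose t i := f ^+ i.+1 * (p * a) * (q * a ^+ i).
have [| |S tS] := cvg_root_norm_series _ t (rnorm (1 : A) * rnorm (f * (p * a)))
  (rnorm f) _ (rnorm_ge0 f) qa.
- by rewrite mulr_ge0 ?rnorm_ge0.
- move=> n; apply: (le_trans (ler_rnormM _ _)); rewrite ler_wpM2r ?rnorm_ge0//.
  rewrite exprSr -mulrA mulrAC; apply: (le_trans (ler_rnormM _ _)).
  by rewrite ler_wpM2r ?rnorm_ge0// ler_rnormX.
(* Identities for [S] are checked on partial sums and passed to the limit. *)
have limE x y z (u : nat -> A) : u @ \oo --> z ->
    (forall n, x * series t n * y = u n) -> x * S * y = z.
  move=> uz xty; apply: (@cvg_unique _ (@norm_hausdorff _ A)) uz.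
  by have := cvg_mul_seq x y _ _ tS; under eq_fun do rewrite xty.
have pS : p * S = S.
  rewrite -[LHS]mulr1; apply: (limE _ _ _ _ tS) => n.
  rewrite mulr1 mulr_sumr; apply: eq_bigr => i _.
  by rewrite /t exprS !mulrA pf.
have Sp : S * p = 0.
  rewrite -[S]mul1r; apply: (limE _ _ _ (fun=> 0)); first exact: cvg_cst.
  move=> n; rewrite mul1r mulr_suml big1// => i _.
  by rewrite /t -!mulrA (mulrA q) qzp// !mulr0.
have at0 : a * t 0 = p * a * q.
  by rewrite /t expr1 expr0 mulr1 !mulrA af pp.
have atS n : a * t n.+1 = t n * a.
  by rewrite /t (exprS f n.+1) (exprS f n) !mulrA af pf -!mulrA exprSr.
have ast n : a * series t n.+1 = p * a * q + series t n * a.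
  elim: n => [|n IHn].
    by rewrite !seriesEnat/= big_nat1 big_geq// mul0r addr0.
  by rewrite seriesSr mulrDr IHn atS seriesSr mulrDl addrA.
have aS : a * S = p * a * q + S * a.
  have tS1 : (fun n => p * a * q + 1 * series t n * a) @ \oo
      --> p * a * q + S * a.
    by apply: cvgD; [exact: cvg_cst|rewrite -[S]mul1r; exact: cvg_mul_seq].
  apply: (@cvg_unique _ (@norm_hausdorff _ A)) tS1.
  have := cvg_mul_seq a 1 _ _ tS; rewrite mulr1 -cvg_shiftS /=.
  by under eq_fun do rewrite mulr1 ast -[series t _]mul1r.
pose p' := p + S.
have pp' : p * p' = p' by rewrite mulrDr pp pS.
have p'p : p' * p = p by rewrite mulrDl pp Sp addr0.
(* The Sylvester equation supplies the missing corner: [a * p + p * a * q = p * a]. *)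
have ap' : a * p' = p' * a.
  rewrite mulrDr mulrDl aS addrA; congr (_ + _).
  by rewrite -pap -mulrDr addrC subrK mulr1.
pose e := f * p'.
have ae : a * e = p' by rewrite /e mulrA af.
have q'a : root_norm_cvg0 (fun n => (1 - p') * a ^+ n).
  (* [1 - p'] kills [p], hence factors through [q] and inherits its decay. *)
  have q'q : (1 - p') * q = 1 - p'.
    by rewrite mulrBr mulr1 mulrBl mul1r p'p subrr subr0.
  apply/(@eq_root_norm_cvg0 _ _ _ (fun n => (1 - p') * (q * a ^+ n))).
    by move=> n _; rewrite mulrA q'q.
  exact: root_norm_cvg0_mull.
exists e; last by rewrite ae.
split; first by rewrite expr2 mulrA ae /e mulrA -{1}pf mulrA p'p pf.
  by rewrite expr2 -mulrA ae ap'.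
rewrite ae; have -> : a - p' * a = (1 - p') * a by rewrite mulrBl mul1r.
apply/qnil_compress => //.
have p'p' : p' * p' = p' by rewrite -{2}pp' mulrA p'p.
have q'p' : (1 - p') * p' = 0 by rewrite mulrBl mul1r p'p' subrr.
by rewrite mulrBr mulr1 -[X in _ - X]mulrA ap' mulrA q'p' mul0r subr0.
Qed.

(** * Transfer of group inverses between an element and its power *)

Lemma m_gen_right_group_inverse_of_pow a y k :
  gen_right_group_inverse (a ^+ k.+1) y ->
  m_gen_right_group_inverse k.+1 a (a ^+ k * y).
Proof.
case=> d [bd yE starE limE].
have [e ae pe] := gen_right_drazin_root _ _ _ bd.
have axE : a * (a ^+ k * y) = a ^+ k.+1 * y by rewrite mulrA -exprS.
exists e; split => //.
(* With [b = a ^+ k.+1] the claim reads [(1 - b * y) * a ^+ k * y = 0], an annihilation with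
   [z = a ^+ k]. *)
- move/root_norm_cvg0_subE: limE => limE.
  apply/esym/eqP; rewrite expr2 mulrA axE -subr_eq0 -oppr_eq0 opprB.
  rewrite -[X in X - _]mul1r -mulrBl mulrA.
  by apply/eqP/(root_norm_cvg0_annihilates _ _ _ _ _ _ limE) => //;
     rewrite -!exprD addnC.
- have aE : a ^+ k.+2 * (a ^+ k * y) = (a ^+ k.+1) ^+ 2 * y.
    by rewrite mulrA -exprD -exprM muln2 -addnn addSnnS.
  rewrite expr1 in starE; rewrite -mulrA aE -pe starM.
  by rewrite -!(mulrA (star (a * e))) [X in _ * X]mulrA starE.
- rewrite axE; apply/root_norm_cvg0_subE/(root_norm_cvg0_pow k.+1) => //.
  exact/root_norm_cvg0_subE.
Qed.

Lemma gen_right_group_inverse_pow a x k :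
  m_gen_right_group_inverse k.+1 a x ->
  gen_right_group_inverse (a ^+ k.+1) (x ^+ k.+1).
Proof.
case=> d [ad xE starE limE]; have [ad2 _ _] := ad.
have axX : a ^+ k.+1 * x ^+ k.+1 = a * x by exact: exprMX_right_inv.
exists (d ^+ k.+1); split; first exact: gen_right_drazin_invX.
- by rewrite -exprM muln2 -addnn exprM_right_inv.
(* As [a ^+ k.+1 * d ^+ k.+1 = a * d], this makes the condition coincide with [starE]. *)
- have aE : (a ^+ k.+1) ^+ 2 * x ^+ k.+1 = a ^+ k.+2 * x.
    by rewrite expr2 -mulrA axX mulrA -exprSr.
  by rewrite exprMX_right_inv// expr1 -mulrA aE mulrA starE.
- rewrite axX; apply/root_norm_cvg0_subE/root_norm_cvg0_pow => //.
  exact/root_norm_cvg0_subE.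
Qed.

End GeneralizedInverses.

Theorem theorem2p1 (R : realType) (A : banachStarAlg R)
    (A_proper : proper_star A) (a : A) (m : nat) (m_ge1 : (1 <= m)%N) :
  ((exists x : A, m_gen_right_group_inverse m a x) <->
   (exists y : A, gen_right_group_inverse (a ^+ m) y)) /\
  (forall y : A, gen_right_group_inverse (a ^+ m) y ->
     m_gen_right_group_inverse m a (a ^+ m.-1 * y)) /\
  (forall x : A, m_gen_right_group_inverse m a x ->
     gen_right_group_inverse (a ^+ m) (x ^+ m)).
Proof.
case: m m_ge1 => // k _.
split; last first.
  by split=> ?; [exact: m_gen_right_group_inverse_of_pow|
                 exact: gen_right_group_inverse_pow].
split=> [[x]|[y]].
  by move=> /gen_right_group_inverse_pow ?; exists (x ^+ k.+1).
by move=> /m_gen_right_group_inverse_of_pow ?; exists (a ^+ k * y).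
Qed.
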